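(* Let $\mathcal{X}\subseteq\mathbb{R}^d$, let $\pi:\mathcal{X}\to\mathbb{R}^+$ be a density, let $\sigma>0$, $\lambda>0$, $M\ge 1$, and let $\kappa(x,y)=\exp\bigl(-\tfrac{1}{2\sigma^{2}}\|x-y\|^2\bigr)$ be the squared exponential kernel. Define $F^\pi_\lambda:\mathbb{R}^M\times\mathcal{X}^M\to\mathbb{R}$ by $$F^\pi_\lambda(\bm{w},Y)=\tfrac12\,\mathrm{MMD}^2\Bigl(\pi,\sum_{i=1}^M w_i\delta_{y_i}\Bigr)+\tfrac{\lambda}{2}\|\bm{w}\|^2,$$ and $F^\pi_{M,\lambda}(Y)=\inf_{\bm{w}\in\mathbb{R}^M}F^\pi_\lambda(\bm{w},Y)$ for $Y\in\mathcal{X}^M$. Then for every $Y\in\mathcal{X}^M$, $$\nabla F^\pi_{M,\lambda}(Y)=\sigma^{-2}\,\bm{W}^*_\lambda(Y)\Bigl(\bm{K}_\lambda(Y)\,\bm{W}^*_\lambda(Y)\,Y-\bm{v}_1(Y)\Bigr),$$ where $\bm{K}_\lambda(Y)=\bm{K}(Y)+\lambda\bm{I}_M$ and $\bm{W}^*_\lambda(Y)=\mathrm{diag}(\bm{w}^*_\lambda(Y))$ with $\bm{w}^*_\lambda(Y)=\bm{K}_\lambda(Y)^{-1}\bm{v}_0(Y)$.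
   Context: A configuration $Y\in\mathcal{X}^M$ of points $y_1,\dots,y_M\in\mathcal{X}\subseteq\mathbb{R}^d$ is identified with the $M\times d$ matrix whose $i$-th row is $y_i$. The kernel matrix is $\bm{K}(Y)\in\mathbb{R}^{M\times M}$, $[\bm{K}(Y)]_{ij}=\kappa(y_i,y_j)$. A density is a nonnegative Lebesgue-integrable function $\pi$ on $\mathcal{X}$ (not identically zero; it need not be normalized), and $\mathrm{d}\pi(x)=\pi(x)\,\mathrm{d}x$. Define $$v_0(y)=\int_{\mathcal{X}}\kappa(x,y)\,\mathrm{d}\pi(x)\in\mathbb{R},\qquad v_1(y)=\int_{\mathcal{X}}x\,\kappa(x,y)\,\mathrm{d}\pi(x)\in\mathbb{R}^d,$$ let $\bm{v}_0(Y)\in\mathbb{R}^M$ have $i$-th entry $v_0(y_i)$, and let $\bm{v}_1(Y)\in\mathbb{R}^{M\times d}$ have $i$-th row $v_1(y_i)$. For a vector $\bm{w}\in\mathbb{R}^M$, $\mathrm{diag}(\bm{w})$ is the diagonal matrix with diagonal $\bm{w}$. The squared maximum mean discrepancy between (finite, possibly signed) measures $\mu,\nu$ is $$\mathrm{MMD}^2(\mu,\nu)=\iint\kappa\,\mathrm{d}\mu\,\mathrm{d}\mu-2\iint\kappa\,\mathrm{d}\mu\,\mathrm{d}\nu+\iint\kappa\,\mathrm{d}\nu\,\mathrm{d}\nu .$$ The gradient $\nabla F^\pi_{M,\lambda}(Y)\in\mathbb{R}^{M\times d}$ has $(i,j)$ entry the partial derivative with respect to the $j$-th coordinate of $y_i$.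 (Since $\kappa$ is defined on $\mathbb{R}^d\times\mathbb{R}^d$, $F^\pi_{M,\lambda}$ is given by the same formulas for all $Y\in\mathbb{R}^{M\times d}$, so these partial derivatives make sense.) *)

(* Defs.v *)
From HB Require Import structures.
From mathcomp Require Import all_boot all_order all_algebra.
From mathcomp Require Import all_classical all_reals all_analysis.

Set Implicit Arguments.
Unset Strict Implicit.
Unset Printing Implicit Defensive.
Import Order.TTheory GRing.Theory Num.Theory.
Import numFieldNormedType.Exports.

Local Open Scope classical_set_scope.
Local Open Scope ring_scope.

Section lebesgue_outer.
Context {R : realType} {d : nat}.
Implicit Types (A : set 'rV[R]_d) (a b : 'rV[R]_d).
Local Open Scope ereal_scope.

Definition obox a b : set 'rV[R]_d :=
  [set x | forall j, (a 0 j < x 0 j <= b 0 j)%R].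

Definition obox_volume a b : R := (\prod_(j < d) (b 0 j - a 0 j))%R.

(* Covers are indexed by an arbitrary D : set nat, so that the empty set has
   the empty cover; this matters for d = 0, where every box is the whole space
   and has volume 1. *)
Definition lebesgue_outer A : \bar R :=
  ereal_inf [set s | exists (D : set nat) (a b : nat -> 'rV[R]_d),
    [/\ forall k j, (a k 0 j <= b k 0 j)%R,
        A `<=` \bigcup_(k in D) obox (a k) (b k) &
        s = \esum_(k in D) (obox_volume (a k) (b k))%:E]].

Let obox_volume_ge0 a b : (forall j, a 0 j <= b 0 j)%R ->
  0 <= (obox_volume a b)%:E.
Proof. by move=> ab; rewrite lee_fin prodr_ge0// => j _; rewrite subr_ge0. Qed.

Let lebesgue_outer_ge0 A : 0 <= lebesgue_outer A.
Proof.
apply: le_ereal_inf_tmp => _ [D [a [b [ab _ ->]]]].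
by apply: esum_ge0 => k _; exact: obox_volume_ge0.
Qed.

Let lebesgue_outer0 : lebesgue_outer set0 = 0.
Proof.
apply/eqP; rewrite eq_le lebesgue_outer_ge0 andbT.
apply: ereal_inf_lbound; exists set0, (fun=> 0%R), (fun=> 0%R).
by split => //; rewrite esum_set0.
Qed.

Let le_lebesgue_outer : {homo lebesgue_outer : A B / A `<=` B >-> A <= B}.
Proof.
move=> A B AB; apply/ereal_inf_le_tmp => _ [D [a [b [ab BD ->]]]].
by exists D, a, b; split => //; exact: subset_trans BD.
Qed.

Let lebesgue_outer_sigma_subadditive : sigma_subadditive lebesgue_outer.
Proof.
move=> A; have [[i ioo]|] := pselect (exists i, lebesgue_outer (A i) = +oo).
  rewrite (eseries_pinfty _ _ ioo) ?leey// => n _.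
  by rewrite -ltNye (lt_le_trans _ (lebesgue_outer_ge0 _)).
rewrite -forallNE => Aoo.
apply/lee_addgt0Pr => e e0.
rewrite (le_trans _ (epsilon_trick _ _ (ltW e0)))//.
pose P n (c : set nat * (nat -> 'rV[R]_d) * (nat -> 'rV[R]_d)) :=
  [/\ forall k j, (c.1.2 k 0 j <= c.2 k 0 j)%R,
      A n `<=` \bigcup_(k in c.1.1) obox (c.1.2 k) (c.2 k) &
      \esum_(k in c.1.1) (obox_volume (c.1.2 k) (c.2 k))%:E <=
      lebesgue_outer (A n) + (e / (2 ^ n.+1)%:R)%:E].
have [G PG] : {G & forall n, P n (G n)}.
  apply: (@choice _ _ P) => n.
  have en1 : (0 < e / (2 ^ n.+1)%:R)%R by rewrite divr_gt0.
  have /(lb_ereal_inf_adherent en1)[_ [D [a [b [ab AD ->]]]] se] :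
      lebesgue_outer (A n) \is a fin_num.
    rewrite ge0_fin_numE// ltey; apply/eqP; exact: Aoo.
  by exists (D, a, b); split => //; exact: ltW.
have /card_esym/ppcard_eqP[f] := card_nat2.
pose u (p : nat * nat) := (G p.1).1.2 p.2.
pose v (p : nat * nat) := (G p.1).2 p.2.
pose K : set (nat * nat) := setT `*`` (fun n => (G n).1.1).
have uv p j : (u p 0 j <= v p 0 j)%R by have [+ _ _] := PG p.1; exact.
apply: (@le_trans _ _ (\esum_(p in K) (obox_volume (u p) (v p))%:E)).
  apply: ereal_inf_lbound; exists (f @^-1` K), (u \o f), (v \o f); split.
  - by move=> k j; exact: uv.
  - move=> x [n _ Anx]; have [_ + _] := PG n => /(_ x Anx)[k Dk xk].
    have /= fnk : f (f^-1%FUN (n, k)) = (n, k) by rewrite invK ?inE.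
    by exists (f^-1%FUN (n, k)); rewrite /= fnk.
  - rewrite (reindex_esum (f @^-1` K) K f)//=.
    split => //=.
    + by move=> p q _ _ fpq; exact: injT fpq.
    + move=> p Kp; exists (f^-1%FUN p); rewrite /= invK ?inE//.
rewrite -(@esum_esum _ _ _ _ _ (fun n k => (obox_volume (u (n, k)) (v (n, k)))%:E))//; last first.
  by move=> *; exact: obox_volume_ge0.
rewrite nneseries_esumT; last by move=> n; rewrite adde_ge0// lee_fin divr_ge0// ltW.
by apply: le_esum => n _; have [] := PG n.
Qed.

HB.instance Definition _ := isOuterMeasure.Build R _ lebesgue_outer
  lebesgue_outer0 lebesgue_outer_ge0 le_lebesgue_outer
  lebesgue_outer_sigma_subadditive.

End lebesgue_outer.

(* A copy of 'rV[R]_d carrying the Lebesgue sigma-algebra, in the form of the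
   sets that are Caratheodory measurable for the Lebesgue outer measure. *)
Definition lebesgue_space (R : realType) (d : nat) :=
  caratheodory_type (@lebesgue_outer R d).
HB.instance Definition _ R d := Measurable.on (lebesgue_space R d).

Definition lebesgue_rV {R : realType} {d : nat} :
  set (lebesgue_space R d) -> \bar R := @lebesgue_outer R d.
HB.instance Definition _ R d :=
  isMeasure.Build _ (lebesgue_space R d) R (@lebesgue_rV R d)
    (caratheodory_measure0 _) (@caratheodory_measure_ge0 _ _ _)
    (@caratheodory_measure_sigma_additive _ _ _).

(* Integral of a function against a signed measure, through its Jordan
   decomposition. *)
Section charge_integral.
Context {disp : measure_display} {T : measurableType disp} {R : realType}.
Implicit Types (nu : {charge set T -> \bar R}) (f : T -> R).

Lemma hahn_ex nu :
  exists PN : set T * set T, hahn_decomposition nu PN.1 PN.2.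
Proof. by have [P [N h]] := Hahn_decomposition nu; exists (P, N). Qed.

Definition hahn_dec nu := projT2 (cid (hahn_ex nu)).

Definition charge_integral nu f : R :=
  \int[jordan_pos (hahn_dec nu)]_x f x - \int[jordan_neg (hahn_dec nu)]_x f x.

Definition mmd2 (k : T -> T -> R) (mu nu : {charge set T -> \bar R}) : R :=
  charge_integral mu (fun y => charge_integral mu (fun x => k x y))
  - 2 * charge_integral nu (fun y => charge_integral mu (fun x => k x y))
  + charge_integral nu (fun y => charge_integral nu (fun x => k x y)).

Definition charge_add (mu nu : {charge set T -> \bar R}) :
  {charge set T -> \bar R} := cadd mu nu.

Definition weighted_diracs (M : nat) (w : 'I_M -> R) (y : 'I_M -> T) :
    {charge set T -> \bar R} :=
  \big[charge_add/czero : {charge set T -> \bar R}]_(i < M)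
    (cscale (w i) (charge_of_finite_measure \d_(y i))
      : {charge set T -> \bar R}).

End charge_integral.

(* Integrability over X is stated for the extension by 0 outside X: it then
   makes sense for every X, and for measurable X it is integrability on X. *)
Record density (R : realType) (d : nat) (X : set 'rV[R]_d) := Density {
  pdf :> 'rV[R]_d -> R ;
  pdf_ge0 : forall x, X x -> 0 <= pdf x ;
  pdf_neq0 : exists2 x, X x & pdf x != 0 ;
  pdf_integrable : lebesgue_rV.-integrable [set: lebesgue_space R d]
    (EFin \o (pdf \_ X)) }.

Definition charge_of_density (R : realType) (d : nat) (X : set 'rV[R]_d)
    (pi : density X) : {charge set (lebesgue_space R d) -> \bar R} :=
  induced_charge (pdf_integrable pi).

(* Squared Euclidean (Frobenius) norm: the library norm `|A| on matrices is the
   sup norm. *)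
Definition sqnorm (R : realType) (m n : nat) (A : 'M[R]_(m, n)) : R :=
  \sum_(i < m) \sum_(j < n) A i j ^+ 2.

Section regularised_mmd.
Context {R : realType} {d : nat} (X : set 'rV[R]_d) (pi : density X).
Context (sigma lambda : R) {M : nat}.
Implicit Types (w : 'cV[R]_M) (Y : 'M[R]_(M, d)).

Definition se_kernel (x y : 'rV[R]_d) : R :=
  expR (- (2 * sigma ^+ 2)^-1 * sqnorm (x - y)).

Definition kernel_mx Y : 'M[R]_M :=
  \matrix_(i, j) se_kernel (row i Y) (row j Y).

Definition v0 (y : 'rV[R]_d) : R :=
  \int[lebesgue_rV]_(x in X) (se_kernel x y * pi x).

Definition v1 (y : 'rV[R]_d) : 'rV[R]_d :=
  \row_j \int[lebesgue_rV]_(x in X) (x 0 j * se_kernel x y * pi x).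

Definition v0_vec Y : 'cV[R]_M := \col_i v0 (row i Y).

Definition v1_mx Y : 'M[R]_(M, d) := \matrix_i v1 (row i Y).

Definition F_weights w Y : R :=
  2^-1 * mmd2 (T := lebesgue_space R d) se_kernel (charge_of_density pi)
           (weighted_diracs (T := lebesgue_space R d) (fun i => w i 0) (fun i => row i Y))
  + lambda / 2 * sqnorm w.

Definition F_opt Y : R := inf (range (fun w => F_weights w Y)).

Definition kernel_reg_mx Y : 'M[R]_M := kernel_mx Y + lambda%:M.

Definition opt_weights Y : 'cV[R]_M := invmx (kernel_reg_mx Y) *m v0_vec Y.

Definition opt_weights_mx Y : 'M[R]_M := diag_mx (opt_weights Y)^T.

End regularised_mmd.

Definition is_gradient (R : realType) (m n : nat) (f : 'M[R]_(m, n) -> R)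
    (Y G : 'M[R]_(m, n)) : Prop :=
  forall i j, is_derive Y (delta_mx i j) f (G i j).

(* Main.v *)
(* Integrating against the measures in the MMD turns [F_weights] into the
   quadratic function [C - w^T v0 + w^T K w / 2 + lambda |w|^2 / 2] of the
   weights. As K is positive semidefinite, completing the square around the
   optimal weights [w] of [Y] gives, for every configuration [Z],
     F_weights w Z - |r Z|^2 / (2 lambda) <= F_opt Z <= F_weights w Z
   where [r Z = v0 Z - (K Z + lambda) w] vanishes at [Z = Y]. Along a line
   through [Y] the two bounds agree to first order, so [F_opt] has the same
   partial derivatives at [Y] as [F_weights w], and neither the infimum nor the
   inverse matrix has to be differentiated. *)

Require Import Defs.
From mathcomp Require Import all_boot all_order all_algebra.
From mathcomp Require Import all_classical all_reals all_analysis.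
From mathcomp Require Import measurable_realfun ring lra.
Import Order.TTheory GRing.Theory Num.Theory.
Import numFieldNormedType.Exports.
Local Open Scope classical_set_scope.
Local Open Scope ring_scope.
Set Implicit Arguments.
Unset Strict Implicit.
Unset Printing Implicit Defensive.

(** * Lebesgue measurability of the coordinates *)

Section lebesgue_space.
Context {R : realType} {d : nat}.
Implicit Types a b x : 'rV[R]_d.

Definition set_coord a (j : 'I_d) (c : R) : 'rV[R]_d :=
  \row_k (if k == j then c else a 0 k).

(** The three products share every factor but the [j]-th, where
    [b_j - a_j = (c - a_j) + (b_j - c)]. *)
Lemma obox_volume_split a b j c :
  obox_volume a b = obox_volume a (set_coord b j c) + obox_volume (set_coord a j c) b.
Proof.
rewrite /obox_volume (bigD1 j)//= [X in _ = X + _](bigD1 j)//=.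
rewrite [X in _ = _ + X](bigD1 j)//= !mxE eqxx.
rewrite [X in _ = _ * X + _](eq_bigr (fun k => b 0 k - a 0 k)); last first.
  by move=> k /negbTE kj; rewrite mxE kj.
rewrite [X in _ = _ + _ * X](eq_bigr (fun k => b 0 k - a 0 k)); last first.
  by move=> k /negbTE kj; rewrite mxE kj.
by ring.
Qed.

(* The hyperplane cuts each box of a cover into two boxes with the same total
   volume. *)
Let lebesgue_outer_halfspace (j : 'I_d) (c : R) :
  (@lebesgue_outer R d).-caratheodory [set x | x 0 j <= c].
Proof.
apply: le_caratheodory_measurable => A.
rewrite /= {3}/lebesgue_outer; apply: le_ereal_inf_tmp => _ [D [a [b [ab AD ->]]]].
(* [m k] is [c] clamped to the [j]-th side of the box, so that both pieces keep ordered corners;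
   when the hyperplane misses the box, one piece degenerates to volume 0. *)
pose m k := Num.min (b k 0 j) (Num.max (a k 0 j) c).
have am k : a k 0 j <= m k by rewrite le_min ab/= le_max lexx.
have mb k : m k <= b k 0 j by rewrite ge_min lexx.
pose b' k := set_coord (b k) j (m k).
pose a' k := set_coord (a k) j (m k).
have ab' k i : a k 0 i <= b' k 0 i.
  by rewrite mxE; case: eqP => [->|_].
have a'b k i : a' k 0 i <= b k 0 i.
  by rewrite mxE; case: eqP => [->|_].
have vol_ge0 (u v : 'rV[R]_d) : (forall i, u 0 i <= v 0 i) ->
    (0 <= (@obox_volume R d u v)%:E)%E.
  by move=> uv; rewrite lee_fin prodr_ge0// => i _; rewrite subr_ge0.
under eq_esum => k _ do rewrite (obox_volume_split (a k) (b k) j (m k)) EFinD.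
rewrite esumD; [|by move=> k _; apply: vol_ge0; exact: ab'|by move=> k _; apply: vol_ge0; exact: a'b].
apply: leeD.
  apply: ereal_inf_lbound; exists D, a, b'; split => //.
  move=> x [/AD [k Dk xk] /= xc]; exists k => // i.
  have /andP[axi xbi] := xk i.
  rewrite axi mxE/=; case: eqP => [ij|//]; subst i.
  by rewrite le_min xbi le_max xc orbT.
apply: ereal_inf_lbound; exists D, a', b; split => //.
move=> x [/AD [k Dk xk] /= /negP xc]; exists k => // i.
have /andP[axi xbi] := xk i.
rewrite xbi andbT mxE; case: eqP => [ij|//]; subst i.
by rewrite gt_min gt_max axi/= [c < _]ltNge xc orbT.
Qed.

(** Open upper rays generate the Borel sets, and the preimage of such a ray is the complement of a
    Caratheodory measurable half-space. *)
Lemma measurable_coord (j : 'I_d) :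
  measurable_fun [set: lebesgue_space R d]
    (fun x : lebesgue_space R d => (x : 'rV[R]_d) 0 j).
Proof.
move=> mT; apply: (measurability _ (RGenOInfty.measurableE R)) => //.
move=> _ [_ [c ->] <-]; rewrite setTI.
rewrite (_ : _ @^-1` _ = ~` [set x : lebesgue_space R d | (x : 'rV[R]_d) 0 j <= c]).
  by apply: measurableC; exact: lebesgue_outer_halfspace.
by apply/seteqP; split => x /=; rewrite in_itv/= andbT ltNge => /negP.
Qed.

End lebesgue_space.

(** * Integrals against signed measures *)

Section charge_integral.
Context {disp : measure_display} {T : measurableType disp} {R : realType}.
Implicit Types (nu : {charge set T -> \bar R}) (m : {measure set T -> \bar R}).
Implicit Types (f : T -> R).

(** A class of integrands integrable against every finite measure, hence against both Jordan parts
    of any charge. *)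
Definition bounded_measurable f :=
  measurable_fun [set: T] f /\ exists C, forall x, `|f x| <= C.

Lemma bounded_measurable_integrable m f : (m [set: T] < +oo)%E ->
  bounded_measurable f -> m.-integrable [set: T] (EFin \o f).
Proof.
move=> mT [mf [C fC]]; apply: measurable_bounded_integrable => //.
exists C; split; first exact: num_real.
by move=> M CM x _ /=; rewrite (le_trans (fC x))// ltW.
Qed.

(** Moving the subtracted terms across gives the equality of measures [m3 + m2 = m1 + m4];
    integrating it and moving back is legitimate because all four integrals are finite. *)
Lemma Rintegral_measureB (m1 m2 m3 m4 : {measure set T -> \bar R}) f :
  bounded_measurable f ->
  (m1 [set: T] < +oo)%E -> (m2 [set: T] < +oo)%E ->
  (m3 [set: T] < +oo)%E -> (m4 [set: T] < +oo)%E ->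
  (forall A, measurable A -> m1 A - m2 A = m3 A - m4 A)%E ->
  \int[m1]_x f x - \int[m2]_x f x = \int[m3]_x f x - \int[m4]_x f x.
Proof.
move=> bmf m1T m2T m3T m4T mE.
have fin m A : (m [set: T] < +oo)%E -> measurable A -> m A \is a fin_num.
  move=> mT mA; rewrite ge0_fin_numE//; apply: le_lt_trans mT.
  by apply: le_measure; rewrite ?inE.
have i m := @bounded_measurable_integrable m f ^~ bmf.
have mf : measurable_fun setT (EFin \o f) by apply/measurable_EFinP; case: bmf.
have mE' A : measurable A -> (measure_add m3 m2 A = measure_add m1 m4 A)%E.
  move=> mA; rewrite !measure_addE.
  move: (mE A mA) (fin _ _ m1T mA) (fin _ _ m2T mA) (fin _ _ m3T mA) (fin _ _ m4T mA).
  move: (m1 A) (m2 A) (m3 A) (m4 A) => [x1| |] [x2| |] [x3| |] [x4| |]// H _ _ _ _.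
  by move: H; rewrite -!EFinB -!EFinD => -[H]; congr (_%:E); lra.
have : (\int[measure_add m3 m2]_x (f x)%:E = \int[measure_add m1 m4]_x (f x)%:E)%E.
  by apply: eq_measure_integral => A mA _; exact: mE'.
rewrite !integral_measure_add//; try exact: i.
rewrite /Rintegral -!/(comp EFin f).
have f1 m : (m [set: T] < +oo)%E -> (\int[m]_x (EFin \o f) x)%E \is a fin_num.
  by move=> mT; apply: integrable_fin_num => //; exact: i.
move: (f1 _ m1T) (f1 _ m2T) (f1 _ m3T) (f1 _ m4T); rewrite /=.
move: (\int[m1]_x _)%E (\int[m2]_x _)%E (\int[m3]_x _)%E (\int[m4]_x _)%E.
move=> [x1| |] [x2| |] [x3| |] [x4| |]// _ _ _ _.
by rewrite -!EFinD => -[H] /=; lra.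
Qed.

Let jordan_fin nu : (jordan_pos (hahn_dec nu) [set: T] < +oo)%E /\
                    (jordan_neg (hahn_dec nu) [set: T] < +oo)%E.
Proof. by split; rewrite ltey_eq fin_num_measure. Qed.

Let jordanE nu A : measurable A ->
  (nu A = jordan_pos (hahn_dec nu) A - jordan_neg (hahn_dec nu) A)%E.
Proof. by move=> mA; rewrite [LHS](jordan_decomp (hahn_dec nu))//= /cadd/= cscaleN1. Qed.

(** Frees the integral from the chosen Hahn decomposition: any two finite measures with difference
    [nu] may replace its Jordan parts. *)
Lemma charge_integralE nu (m1 m2 : {measure set T -> \bar R}) f :
  bounded_measurable f -> (m1 [set: T] < +oo)%E -> (m2 [set: T] < +oo)%E ->
  (forall A, measurable A -> nu A = m1 A - m2 A)%E ->
  charge_integral nu f = \int[m1]_x f x - \int[m2]_x f x.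
Proof.
move=> bmf m1T m2T nuE; have [pT nT] := jordan_fin nu.
by apply: Rintegral_measureB => // A mA; rewrite -nuE// -jordanE.
Qed.

Let measure_add_lty m1 m2 : (m1 [set: T] < +oo)%E -> (m2 [set: T] < +oo)%E ->
  (measure_add m1 m2 [set: T] < +oo)%E.
Proof. by move=> m1T m2T; rewrite measure_addE lte_add_pinfty. Qed.

(** The sums of the positive and of the negative parts represent [nu1 + nu2], although they need not
    be its Jordan decomposition. *)
Lemma charge_integralD nu1 nu2 f : bounded_measurable f ->
  charge_integral (charge_add nu1 nu2) f =
  charge_integral nu1 f + charge_integral nu2 f.
Proof.
move=> bmf.
have mf : measurable_fun setT (EFin \o f) by apply/measurable_EFinP; case: bmf.
have [p1T n1T] := jordan_fin nu1; have [p2T n2T] := jordan_fin nu2.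
have i m := @bounded_measurable_integrable m f ^~ bmf.
have f1 m : (m [set: T] < +oo)%E -> (\int[m]_x (f x)%:E)%E \is a fin_num.
  by move=> mT; apply: integrable_fin_num => //; exact: i.
rewrite (@charge_integralE _
  (measure_add (jordan_pos (hahn_dec nu1)) (jordan_pos (hahn_dec nu2)))
  (measure_add (jordan_neg (hahn_dec nu1)) (jordan_neg (hahn_dec nu2))))//.
- rewrite /Rintegral !integral_measure_add//; try exact: i.
  rewrite /charge_integral /Rintegral.
  move: (f1 _ p1T) (f1 _ p2T) (f1 _ n1T) (f1 _ n2T).
  move: (\int[_]_x _)%E (\int[_]_x _)%E (\int[_]_x _)%E (\int[_]_x _)%E.
  by move=> [x1| |] [x2| |] [x3| |] [x4| |]// _ _ _ _; rewrite -!EFinD /=; ring.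
- exact: measure_add_lty.
- exact: measure_add_lty.
- move=> A mA; transitivity
    (jordan_pos (hahn_dec nu1) A + jordan_pos (hahn_dec nu2) A -
     (jordan_neg (hahn_dec nu1) A + jordan_neg (hahn_dec nu2) A))%E.
    rewrite fin_num_oppeD ?fin_num_measure// addeACA.
    by rewrite -(jordanE nu1 mA) -(jordanE nu2 mA).
  by congr (_ - _)%E; symmetry; exact: measure_addE.
Qed.

Lemma charge_integral0 f : bounded_measurable f ->
  charge_integral (czero : {charge set T -> \bar R}) f = 0.
Proof.
move=> bmf; rewrite (@charge_integralE _ mzero mzero)//; try exact: lt0y.
- by rewrite subrr.
- by move=> A mA; rewrite /czero/= /mzero sube0.
Qed.

(** For [r >= 0] the charge is a measure and for [r < 0] it is minus a measure, so one of the two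
    measures given to [charge_integralE] is zero. *)
Lemma charge_integral_cscale_dirac r a f : bounded_measurable f ->
  charge_integral (cscale r (charge_of_finite_measure \d_a)
    : {charge set T -> \bar R}) f = r * f a.
Proof.
move=> bmf.
have mf : measurable_fun setT (EFin \o f) by apply/measurable_EFinP; case: bmf.
have scaled (k : {nonneg R}) : \int[mscale k \d_a]_x f x = k%:num * f a.
  rewrite /Rintegral integralE !ge0_integral_mscale//; try solve [exact: measurable_funepos|exact: measurable_funeneg].
  rewrite !integral_dirac//; try solve [exact: measurable_funepos|exact: measurable_funeneg].
  rewrite diracT !mul1e !funeposE !funenegE -EFinN -!EFin_max -!EFinM -EFinB /=.
  by rewrite -mulrBr; congr (_ * _); case: (leP (f a) 0) => ?; case: (leP (- f a) 0) => ?; lra.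
have fin (k : {nonneg R}) : (@mscale _ T R k \d_a [set: T] < +oo)%E.
  by rewrite /mscale/= diracT mule1 ltry.
have [r0|r0] := leP 0 r.
  rewrite (@charge_integralE _ (mscale (NngNum r0) \d_a) mzero)//; try solve [exact: lt0y|exact: fin].
  - by rewrite scaled /Rintegral integral_measure_zero subr0.
  - by move=> A mA; rewrite /mzero sube0.
have r1 : 0 <= - r by rewrite oppr_ge0 ltW.
rewrite (@charge_integralE _ mzero (mscale (NngNum r1) \d_a))//; try solve [exact: lt0y|exact: fin].
- by rewrite scaled /Rintegral integral_measure_zero sub0r/= mulNr opprK.
- by move=> A mA; rewrite /mzero sub0e /mscale/= mulNr opprK.
Qed.

Lemma charge_integral_weighted_diracs (M : nat) (w : 'I_M -> R) (y : 'I_M -> T) f :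
  bounded_measurable f ->
  charge_integral (weighted_diracs w y) f = \sum_(i < M) w i * f (y i).
Proof.
move=> bmf; rewrite /weighted_diracs.
apply: (big_ind2 (fun nu v => charge_integral nu f = v)).
- exact: charge_integral0.
- by move=> nu1 v1 nu2 v2 <- <-; exact: charge_integralD.
- by move=> i _; exact: charge_integral_cscale_dirac.
Qed.

End charge_integral.

(** * Integration against a measure with a density *)

Section ge0_integral_density.
Context {disp : measure_display} {T : measurableType disp} {R : realType}.
Import HBNNSimple.

(** The hypothesis on [m] settles indicators, hence simple functions; monotone convergence along
    increasing simple approximations of [f] does the rest. *)
Lemma ge0_integral_density (mu m : {measure set T -> \bar R}) (g f : T -> R) :
  measurable_fun [set: T] g -> (forall x, 0 <= g x) ->
  (forall A, measurable A -> m A = \int[mu]_(x in A) (g x)%:E)%E ->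
  measurable_fun [set: T] f -> (forall x, 0 <= f x) ->
  (\int[m]_x (f x)%:E = \int[mu]_x (f x * g x)%:E)%E.
Proof.
move=> mg g0 mE mf f0.
have mEf : measurable_fun setT (EFin \o f) by exact/measurable_EFinP.
have mEg : measurable_fun setT (EFin \o g) by exact/measurable_EFinP.
pose h := nnsfun_approx measurableT mEf.
have cvgh x : (h n x)%:E @[n --> \oo] --> (f x)%:E.
  by apply: cvg_nnsfun_approx => // ? _ /=; rewrite lee_fin.
have mh n : measurable_fun setT (EFin \o h n) by exact/measurable_EFinP.
have ndh x : {homo (fun n => h n x) : a b / (a <= b)%N >-> a <= b}.
  by move=> a b ab; exact/lefP/nd_nnsfun_approx.
transitivity (limn (fun n => \int[m]_x (h n x)%:E))%E.
  rewrite -monotone_convergence//.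
  - by apply: eq_integral => x _; apply/esym/cvg_lim.
  - by move=> n x _; rewrite lee_fin.
  - by move=> x _ a b ab; rewrite lee_fin ndh.
transitivity (limn (fun n => \int[mu]_x (h n x * g x)%:E))%E; last first.
  rewrite -monotone_convergence//.
  - apply: eq_integral => x _; apply/cvg_lim => //.
    by under eq_fun do rewrite EFinM; rewrite EFinM; apply: cvgeZr.
  - by move=> n; apply/measurable_EFinP/measurable_funM.
  - by move=> n x _; rewrite lee_fin mulr_ge0.
  - by move=> x _ a b ab; rewrite lee_fin ler_wpM2r// ndh.
congr (limn _); apply/funext => n.
(* A simple function is the finite sum over its values [r] of [r] times the indicator of a level
   set; the two integrals are compared level by level. *)
under eq_integral do rewrite fimfunE -fsumEFin//.
rewrite ge0_integral_fsum//; last 2 first.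
  - by move=> r; apply/measurable_EFinP/measurable_funM.
  - by move=> r x _; exact: nnfun_muleindic_ge0.
transitivity (\int[mu]_x (\sum_(r \in range (h n))
    ((r * \1_(h n @^-1` [set r]) x)%:E * (g x)%:E)))%E; last first.
  apply: eq_integral => x _; rewrite -ge0_mule_fsuml => [|r]; last first.
    exact: nnfun_muleindic_ge0.
  by rewrite fsumEFin// -fimfunE EFinM.
rewrite ge0_integral_fsum//; last 2 first.
  - move=> r; apply: emeasurable_funM => //.
    by apply/measurable_EFinP/measurable_funM.
  - move=> r x _; apply: mule_ge0; last by rewrite lee_fin.
    exact: nnfun_muleindic_ge0.
apply: eq_fsbigr => r /[!inE] -[t _ <-].
rewrite integralZl_indic_nnsfun// integral_indic// setIT mE//.
under [RHS]eq_integral do rewrite EFinM -muleA.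
rewrite ge0_integralZl//; last 3 first.
  - by apply: emeasurable_funM => //; exact/measurable_EFinP.
  - by move=> x _; rewrite mule_ge0 ?lee_fin.
  - by rewrite lee_fin.
congr (_ * _)%E; rewrite integral_mkcond; apply: eq_integral => x _.
by rewrite muleC epatch_indic.
Qed.

End ge0_integral_density.

(** * Kernel integrals as functions of the remaining variable *)

Section charge_integral_kernel.
Context {disp : measure_display} {T : measurableType disp} {R : realType}.

(** Makes the inner integrals of the MMD admissible integrands. Tonelli gives measurability against
    each Jordan part, and [0 <= k <= 1] bounds the integral by the total mass. *)
Lemma bounded_measurable_charge_integral (nu : {charge set T -> \bar R})
    (k : T -> T -> R) :
  measurable_fun [set: T * T] (fun xy => k xy.1 xy.2) ->
  (forall x y, 0 <= k x y <= 1) ->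
  bounded_measurable (fun y => charge_integral nu (k ^~ y)).
Proof.
move=> mk k01.
have bk y : bounded_measurable (k ^~ y).
  split; last by exists 1 => x; have /andP[k0 k1] := k01 x y; rewrite ger0_norm.
  exact: (measurableT_comp mk (pair2_measurable y)).
have bm (m : {finite_measure set T -> \bar R}) :
    bounded_measurable (fun y => \int[m]_x k x y).
  have mT : (m [set: T] < +oo)%E by rewrite ltey_eq fin_num_measure.
  split.
    apply: measurableT_comp => //.
    apply: (@measurable_fun_fubini_tonelli_G _ _ T T R m
      (fun xy => (k xy.1 xy.2)%:E)); first exact/measurable_EFinP.
    by move=> xy; rewrite lee_fin; have /andP[] := k01 xy.1 xy.2.
  exists (\int[m]_x 1) => y.
  have k0 : 0 <= \int[m]_x k x y.
    by apply: Rintegral_ge0 => x _; have /andP[] := k01 x y.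
  rewrite ger0_norm//; apply: le_Rintegral => //.
  - exact: bounded_measurable_integrable.
  - apply: bounded_measurable_integrable => //; split => //.
    by exists 1 => x; rewrite normr1.
  - by move=> x _; have /andP[] := k01 x y.
have [mp [Cp pC]] := bm (jordan_pos (hahn_dec nu)).
have [mn [Cn nC]] := bm (jordan_neg (hahn_dec nu)).
split; first exact: measurable_funB.
by exists (Cp + Cn) => y; rewrite (le_trans (ler_normB _ _))// lerD.
Qed.

End charge_integral_kernel.

(** * Positive semidefiniteness of the Gaussian kernel *)

Section gaussian_psd.
Context {R : realType}.

(* [(x_i . x_j)^n] is the Gram matrix of the [n]-fold tensor powers of the [x_i]. *)
Lemma psd_expr_gram (M d n : nat) (x : 'I_M -> 'I_d -> R) (u : 'I_M -> R) :
  0 <= \sum_(i < M) \sum_(j < M) u i * u j * (\sum_(k < d) x i k * x j k) ^+ n.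
Proof.
(* [T f i] is the coordinate at the multi-index [f] of the [n]-fold tensor power of [x i]; the
   double sum is the squared norm of the combination of these tensors with weights [u i]. *)
pose T (f : {ffun 'I_n -> 'I_d}) i := \prod_(l < n) x i (f l).
rewrite (_ : \sum_(i < M) _ = \sum_f (\sum_(i < M) u i * T f i) ^+ 2).
  by apply: sumr_ge0 => f _; exact: sqr_ge0.
under [RHS]eq_bigr => f _ do rewrite expr2 mulr_suml.
rewrite [RHS]exchange_big; apply: eq_bigr => i _ /=.
under [RHS]eq_bigr => f _ do rewrite mulr_sumr.
rewrite [RHS]exchange_big; apply: eq_bigr => j _ /=.
rewrite -[in LHS](card_ord n) -prodr_const bigA_distr_bigA/= mulr_sumr.
by apply: eq_bigr => f _; rewrite /T big_split/=; ring.
Qed.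

Lemma cvg_sumr (I : Type) (r : seq I) (f : I -> nat -> R) (l : I -> R) :
  (forall i, f i n @[n --> \oo] --> l i) ->
  \sum_(i <- r) f i n @[n --> \oo] --> \sum_(i <- r) l i.
Proof.
move=> fl; elim: r => [|i r ih].
  by under eq_fun do rewrite big_nil; rewrite big_nil; exact: cvg_cst.
by under eq_fun do rewrite big_cons; rewrite big_cons; exact: cvgD.
Qed.

(** The exponential is the limit of its Taylor polynomials, whose coefficients [1/k!] are
    nonnegative, so nonnegativity passes from the powers of the Gram matrix to the limit. *)
Lemma psd_expR_gram (M d : nat) (x : 'I_M -> 'I_d -> R) (u : 'I_M -> R) :
  0 <= \sum_(i < M) \sum_(j < M) u i * u j * expR (\sum_(k < d) x i k * x j k).
Proof.
pose g i j := \sum_(k < d) x i k * x j k.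
have cvg_exp : (fun n => \sum_(i < M) \sum_(j < M) u i * u j * series (exp_coeff (g i j)) n)
    @ \oo --> \sum_(i < M) \sum_(j < M) u i * u j * expR (g i j).
  apply: cvg_sumr => i; apply: cvg_sumr => j; apply: cvgMl_tmp.
  exact: is_cvg_series_exp_coeff.
rewrite -(cvg_lim _ cvg_exp)//; apply: limr_ge; first exact: cvgP cvg_exp.
apply: nearW => n.
rewrite (_ : \sum_(i < M) _ = \sum_(0 <= k < n)
   k`!%:R^-1 * \sum_(i < M) \sum_(j < M) u i * u j * g i j ^+ k).
  by apply: sumr_ge0 => k _; rewrite mulr_ge0 ?invr_ge0// psd_expr_gram.
under [RHS]eq_bigr => k _ do rewrite mulr_sumr.
rewrite [RHS]exchange_big; apply: eq_bigr => i _ /=.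
under [RHS]eq_bigr => k _ do rewrite mulr_sumr.
rewrite [RHS]exchange_big; apply: eq_bigr => j _ /=.
rewrite /series/= mulr_sumr; apply: eq_bigr => k _.
by rewrite /exp_coeff/=; ring.
Qed.

(** Expanding the square, [- c |x - y|^2 = - c |x|^2 - c |y|^2 + x.y / sigma^2]; the first two terms
    give factors depending on one point each, which are absorbed into the weights [v]. *)
Lemma psd_se_kernel (sigma : R) (M d : nat) (y : 'I_M -> 'rV[R]_d) (u : 'I_M -> R) :
  0 <= \sum_(i < M) \sum_(j < M) u i * u j * se_kernel sigma (y i) (y j).
Proof.
(* The inverse of 0 is 0, so for [sigma = 0] the kernel is constantly 1 and the form is the square
   of the sum of the weights. *)
have [->|sigma0] := eqVneq sigma 0.
  rewrite (_ : \sum_(i < M) _ = (\sum_(i < M) u i) ^+ 2) ?sqr_ge0//.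
  rewrite expr2 mulr_suml; apply: eq_bigr => i _; rewrite mulr_sumr.
  apply: eq_bigr => j _.
  by rewrite /se_kernel expr0n/= mulr0 invr0 oppr0 mul0r expR0 mulr1.
pose c := (2 * sigma ^+ 2)^-1; pose v i := u i * expR (- c * sqnorm (y i)).
rewrite (_ : \sum_(i < M) _ = \sum_(i < M) \sum_(j < M) v i * v j *
    expR (\sum_(k < d) (y i 0 k / sigma) * (y j 0 k / sigma))).
  exact: psd_expR_gram.
apply: eq_bigr => i _; apply: eq_bigr => j _.
rewrite (_ : v i * v j =
    u i * u j * (expR (- c * sqnorm (y i)) * expR (- c * sqnorm (y j)))); last first.
  by rewrite /v; ring.
rewrite -[in RHS]mulrA -!expRD /se_kernel -/c; congr (_ * expR _).
rewrite /sqnorm !big_ord1 !mulr_sumr -!big_split/=.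
by apply: eq_bigr => k _; rewrite !mxE /c; field.
Qed.

End gaussian_psd.

(** * Symmetry, bounds and measurability of the kernel *)

Section se_kernel_theory.
Context {R : realType} {d : nat}.
Implicit Types (sigma : R) (x y : 'rV[R]_d).

Lemma sqnorm_ge0 (m n : nat) (A : 'M[R]_(m, n)) : 0 <= sqnorm A.
Proof. by apply: sumr_ge0 => i _; apply: sumr_ge0 => j _; exact: sqr_ge0. Qed.

Lemma se_kernelC sigma x y : se_kernel sigma x y = se_kernel sigma y x.
Proof.
rewrite /se_kernel /sqnorm; congr (expR (_ * _)).
by apply: eq_bigr => i _; apply: eq_bigr => j _; rewrite !mxE; ring.
Qed.

Lemma se_kernel_bounds sigma x y : 0 <= se_kernel sigma x y <= 1.
Proof.
rewrite expR_ge0/= expR_le1 mulNr oppr_le0 mulr_ge0 ?sqnorm_ge0//.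
by rewrite invr_ge0 mulr_ge0// sqr_ge0.
Qed.

Lemma measurable_se_kernel sigma :
  measurable_fun [set: (lebesgue_space R d : measurableType _) *
                       (lebesgue_space R d : measurableType _)]
    (fun xy => se_kernel sigma xy.1 xy.2).
Proof.
apply: measurableT_comp => //; apply: measurable_funM => //.
apply: measurable_sum => i; apply: measurable_sum => j; apply: measurable_funX.
rewrite (ord1 i) [X in measurable_fun _ X](_ : _ = (fun xy =>
    (xy.1 : 'rV[R]_d) 0 j - (xy.2 : 'rV[R]_d) 0 j)); last first.
  by apply/funext => xy; rewrite !mxE.
by apply: measurable_funB; apply: (measurableT_comp (measurable_coord j)).
Qed.

Lemma bounded_measurable_se_kernel sigma y :
  bounded_measurable (T := lebesgue_space R d) (se_kernel sigma ^~ y).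
Proof.
split; last first.
  by exists 1 => x; have /andP[k0 k1] := se_kernel_bounds sigma x y; rewrite ger0_norm.
exact: (measurableT_comp (@measurable_se_kernel sigma)
  (pair2_measurable (y : lebesgue_space R d))).
Qed.

End se_kernel_theory.

(** * The objective as an explicit quadratic function of the weights *)

Section regularised_mmd_theory.
Context {R : realType} {d : nat} (X : set 'rV[R]_d) (pi : density X).
Context (sigma lambda : R).
Implicit Types y : 'rV[R]_d.

Let pdf_restrict_ge0 x : 0 <= (pi \_ X) x.
Proof. by rewrite patchE; case: ifPn => // /[!inE]; exact: pdf_ge0. Qed.

(** As the density is nonnegative, the charge is itself a measure, represented with zero negative
    part, and [ge0_integral_density] applies. *)
Lemma charge_integral_density (f : lebesgue_space R d -> R) :
  bounded_measurable f -> (forall x, 0 <= f x) ->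
  charge_integral (charge_of_density pi) f =
  \int[lebesgue_rV]_(x in X) (f x * pi x).
Proof.
move=> bmf f0.
have nu0 E : (0 <= charge_of_density pi E)%E.
  by apply: integral_ge0 => x _; rewrite lee_fin.
rewrite (@charge_integralE _ _ _ _ (measure_of_charge _ nu0) mzero)//; first last.
- by move=> A mA; rewrite /mzero sube0.
- exact: lt0y.
- by rewrite /measure_of_charge ltey_eq fin_num_measure.
have [mp _] := integrableP _ _ _ (pdf_integrable pi).
rewrite /Rintegral integral_measure_zero subr0.
rewrite (@ge0_integral_density _ _ _ lebesgue_rV _ (pi \_ X))//.
- rewrite [in RHS]integral_mkcond; congr fine; apply: eq_integral => x _.
  by rewrite !patchE; case: ifPn => // _; rewrite mulr0.
- exact/measurable_EFinP.
- by case: bmf.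
Qed.

Lemma v0E y : v0 pi sigma y = charge_integral (charge_of_density pi)
  (se_kernel sigma ^~ y : lebesgue_space R d -> R).
Proof.
rewrite charge_integral_density//; first exact: bounded_measurable_se_kernel.
by move=> x; have /andP[] := se_kernel_bounds sigma x y.
Qed.

(* The term of [F_weights] that depends neither on the weights nor on the points. *)
Let c0 : R := 2^-1 * charge_integral (charge_of_density pi)
  (fun y => charge_integral (charge_of_density pi)
    (fun x : lebesgue_space R d => se_kernel sigma x y)).

Lemma F_weightsE (M : nat) (w : 'cV[R]_M) (Y : 'M[R]_(M, d)) :
  F_weights pi sigma lambda w Y = c0 - \sum_(i < M) w i 0 * v0 pi sigma (row i Y)
    + 2^-1 * (\sum_(i < M) \sum_(j < M)
        w i 0 * w j 0 * se_kernel sigma (row i Y) (row j Y))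
    + lambda / 2 * \sum_(i < M) w i 0 ^+ 2.
Proof.
rewrite /F_weights /mmd2 -/c0.
rewrite [X in _ - 2 * X]charge_integral_weighted_diracs; last first.
  apply: bounded_measurable_charge_integral; first exact: measurable_se_kernel.
  by move=> x y; exact: se_kernel_bounds.
(* Evaluating the inner integral for each [y] leaves a finite combination of kernel sections as
   outer integrand, again bounded and measurable. *)
have -> : (fun y => charge_integral
    (weighted_diracs (T := lebesgue_space R d) (fun i => w i 0) (fun i => row i Y))
    (fun x => se_kernel sigma x y)) =
  (fun y => \sum_(i < M) w i 0 * se_kernel sigma (row i Y) y).
  apply/funext => y; rewrite charge_integral_weighted_diracs//.
  exact: bounded_measurable_se_kernel.
rewrite charge_integral_weighted_diracs; last first.
  split.
    apply: measurable_sum => i; apply: measurable_funM => //.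
    exact: (measurableT_comp (@measurable_se_kernel _ _ sigma) (pair1_measurable _)).
  exists (\sum_(i < M) `|w i 0|) => y.
  rewrite (le_trans (ler_norm_sum _ _ _))//; apply: ler_sum => i _.
  have /andP[k0 k1] := se_kernel_bounds sigma (row i Y) y.
  by rewrite normrM (ger0_norm k0) ler_piMr.
rewrite /sqnorm; under [X in lambda / 2 * X]eq_bigr do rewrite big_ord1.
congr (_ + _); rewrite mulrDr mulrBr -/c0 mulrA mulVf// mul1r.
congr (_ - _ + _ * _).
  by apply: eq_bigr => i _; rewrite v0E.
apply: eq_bigr => i _; rewrite mulr_sumr; apply: eq_bigr => j _.
by rewrite mulrA (se_kernelC _ (row j Y)).
Qed.

End regularised_mmd_theory.

(** * Derivatives along a coordinate direction *)

Section difference_quotients.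
Context {R : realType}.

Lemma is_derive_cvg (V : normedModType R) (f : V -> R) (a v : V) (df : R) :
  is_derive a v f df <->
  h^-1 * (f (h *: v + a) - f a) @[h --> 0^'] --> df.
Proof.
split=> [[der <-]|cvg_df]; first exact: der.
by apply: DeriveDef; [exact: cvgP cvg_df|exact: cvg_lim cvg_df].
Qed.

(** Reduces a partial derivative in a space of matrices to the derivative at 0 of a function of one
    real variable. *)
Lemma is_derive_line (V : normedModType R) (f : V -> R) (a v : V) (df : R) :
  is_derive (0 : R) (1 : R) (fun t => f (t *: v + a)) df -> is_derive a v f df.
Proof.
move=> /is_derive_cvg der; apply/is_derive_cvg.
move: der; apply: cvg_trans; apply: near_eq_cvg; near=> h.
by rewrite scale0r add0r addr0 /GRing.scale/= mulr1.
Unshelve. all: by end_near. Qed.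

(** Since [|f - g| <= e] and [e 0 = 0], the difference quotient of [f - g] at 0 is dominated in
    absolute value by that of [e], which tends to 0. *)
Lemma is_derive_squeeze (f g e : R -> R) (dg : R) :
  is_derive (0 : R) (1 : R) g dg -> is_derive (0 : R) (1 : R) e 0 -> e 0 = 0 ->
  (forall t, g t - e t <= f t <= g t) -> is_derive (0 : R) (1 : R) f dg.
Proof.
move=> derg /is_derive_cvg dere e0 gfe.
have fge t : `|(f - g) t| <= e t.
  have /andP[ge fg] := gfe t; rewrite !fctE ler_norml.
  by apply/andP; split; lra.
have fg0 : (f - g) 0 = 0.
  by apply/eqP; rewrite -normr_le0 (le_trans (fge 0))// e0.
suff derfg : is_derive (0 : R) (1 : R) (f - g) 0.
  rewrite (_ : f = g + (f - g)); last by rewrite addrC subrK.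
  by rewrite -[dg]addr0; exact: is_deriveD.
apply/is_derive_cvg; apply: norm_cvg0.
have /cvg_norm := dere; rewrite normr0.
apply: (@squeeze_cvgr _ _ _ _ (cst 0)) => //; last exact: cvg_cst.
near=> h; rewrite normr_ge0/= fg0 e0 !subr0 !normrM ler_wpM2l//.
by rewrite (le_trans (fge _))// ler_norm.
Unshelve. all: by end_near. Qed.

Lemma is_derive_sum_ext (n : nat) (f : 'I_n -> R -> R) (df : 'I_n -> R) (t : R) :
  (forall i, is_derive t (1 : R) (f i) (df i)) ->
  is_derive t (1 : R) (fun s => \sum_(i < n) f i s) (\sum_(i < n) df i).
Proof.
move=> der; have -> : (fun s => \sum_(i < n) f i s) = \sum_(i < n) f i.
  by apply/funext => s; rewrite fct_sumE.
exact: is_derive_sum.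
Qed.

Lemma is_deriveMl (c : R) (f : R -> R) (df t : R) :
  is_derive t (1 : R) f df -> is_derive t (1 : R) (fun s => c * f s) (c * df).
Proof. exact: is_deriveZ. Qed.

End difference_quotients.

(** * The kernel along a coordinate line *)

Section se_kernel_line.
Context {R : realType} {d : nat}.
Implicit Types (sigma : R) (x y u : 'rV[R]_d) (b : 'I_d).
Local Notation "'e_ b" := (delta_mx 0 b : 'rV[R]_d) (at level 8, format "''e_' b").

Lemma sqnorm_line u b (r : R) :
  sqnorm (u + r *: 'e_b) = sqnorm u + 2 * r * u 0 b + r ^+ 2.
Proof.
rewrite /sqnorm !big_ord1 (bigD1 b)//= [in RHS](bigD1 b)//= !mxE !eqxx.
rewrite -![ord0]/(0 : 'I_1) (eq_bigr (fun j => u 0 j ^+ 2)); first by rewrite /=; ring.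
by move=> j /negbTE jb; rewrite !mxE/= jb mulr0 addr0.
Qed.

(* [p] and [q] record how fast each argument moves along the [b]-th coordinate. *)
Lemma is_derive_se_kernel sigma x y b (p q t : R) :
  is_derive t (1 : R)
    (fun s => se_kernel sigma ((s * p) *: 'e_b + x) ((s * q) *: 'e_b + y))
    (- sigma ^- 2 * (p - q) * ((t * p) *: 'e_b + x - ((t * q) *: 'e_b + y)) 0 b
      * se_kernel sigma ((t * p) *: 'e_b + x) ((t * q) *: 'e_b + y)).
Proof.
pose c := - (2 * sigma ^+ 2)^-1; pose u := x - y.
have lineE s : (s * p) *: 'e_b + x - ((s * q) *: 'e_b + y) = u + (s * (p - q)) *: 'e_b.
  by apply/rowP => j; rewrite !mxE; ring.
(* Along the line the exponent is a polynomial of degree at most 2 in [s], so formal differentiation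
   suffices. *)
pose P : {poly R} := (c * sqnorm u)%:P + (c * (2 * (p - q) * u 0 b)) *: 'X
  + (c * (p - q) ^+ 2) *: 'X^2.
have kE s : se_kernel sigma ((s * p) *: 'e_b + x) ((s * q) *: 'e_b + y) = expR P.[s].
  rewrite /se_kernel lineE sqnorm_line -/c /P !(hornerD, hornerC, hornerZ, hornerX, hornerXn).
  by congr (expR _); ring.
rewrite kE (_ : (fun s => _) = expR \o horner P); last by apply/funext => s; exact: kE.
have derP := is_derive1_comp (is_derive_expR P.[t]) (is_derive_poly P t).
apply: is_derive_eq derP _.
rewrite mulrC; congr (_ * _).
rewrite lineE /P !(derivD, derivC, derivZ, derivX, derivXn) /=.
rewrite !(hornerD, hornerC, hornerZ, hornerX, hornerXn, hornerMn) !mxE !eqxx /c /=.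
by rewrite invfM; move: (sigma ^- 2) => i; field.
Qed.

(* [s^2 exp (- c s^2) <= c^-1], as [r <= exp r]. *)
Lemma coord_se_kernel_le sigma x y b : 0 < sigma ->
  `|(x - y) 0 b| * se_kernel sigma x y <= 1 + 2 * sigma ^+ 2.
Proof.
move=> sigma0; set s := (x - y) 0 b; pose c := (2 * sigma ^+ 2)^-1.
have c0 : 0 < c by rewrite invr_gt0 mulr_gt0 ?exprn_gt0.
have /andP[k0 k1] := se_kernel_bounds sigma x y.
have ks : se_kernel sigma x y <= expR (- (c * s ^+ 2)).
  rewrite ler_expR -/c mulNr lerN2 ler_wpM2l ?(ltW c0)//.
  rewrite /sqnorm big_ord1 (bigD1 b)//= lerDl.
  by apply: sumr_ge0 => j _; exact: sqr_ge0.
have sk : c * s ^+ 2 * se_kernel sigma x y <= 1.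
  apply: (le_trans (ler_wpM2l _ ks)); first by rewrite mulr_ge0 ?(ltW c0)// sqr_ge0.
  rewrite expRN ler_pdivrMr ?expR_gt0// mul1r.
  by rewrite (le_trans _ (expR_ge1Dx _))// lerDr.
(* The summand 1 is paid for by [k <= 1], and [s ^+ 2] by [sk], which costs
   [c^-1 = 2 * sigma ^+ 2]. *)
have abs_le : `|s| <= 1 + s ^+ 2.
  by rewrite -real_normK ?num_real//; nra.
apply: (le_trans (ler_wpM2r k0 abs_le)); rewrite mulrDl mul1r lerD//.
rewrite -[leRHS]invrK -/c -[leRHS]mul1r ler_pdivlMr//.
by rewrite mulrC mulrA.
Qed.

End se_kernel_line.

(** * Differentiation of [v0] under the integral sign *)

Section derivative_of_v0.
Context {R : realType} {d : nat} (X : set 'rV[R]_d) (pi : density X).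
Context (sigma : R) (sigma_gt0 : 0 < sigma).
Implicit Types (y : 'rV[R]_d) (b : 'I_d).
Local Notation "'e_ b" := (delta_mx 0 b : 'rV[R]_d) (at level 8, format "''e_' b").
Local Notation T := (lebesgue_space R d).

(** The extension by zero, which turns integrals over [X] into integrals over the whole space. *)
Let p : T -> R := pi \_ X.

Let p_ge0 x : 0 <= p x.
Proof. by rewrite /p patchE; case: ifPn => // /[!inE]; exact: pdf_ge0. Qed.

Let measurable_p : measurable_fun [set: T] p.
Proof. by apply/measurable_EFinP; have [] := integrableP _ _ _ (pdf_integrable pi). Qed.

Let RintegralE (f : T -> R) :
  \int[lebesgue_rV]_(x in X) (f x * pi x) = \int[lebesgue_rV]_x (f x * p x).
Proof.
rewrite Rintegral_mkcond; apply: eq_Rintegral => x _.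
by rewrite /p !patchE; case: ifPn => // _; rewrite mulr0.
Qed.

Let integrable_bounded_mul (f : T -> R) : bounded_measurable f ->
  lebesgue_rV.-integrable [set: T] (EFin \o (fun x => f x * p x)).
Proof.
move=> [mf [C fC]].
have C0 : 0 <= C by exact: le_trans (fC 0).
apply: (le_integrable measurableT _ _ (integrableZl measurableT C (pdf_integrable pi))).
  by apply/measurable_EFinP; exact: measurable_funM.
move=> x _ /=; rewrite -/p !lee_fin !normrM (ger0_norm C0).
by rewrite ler_wpM2r.
Qed.

(** Up to the factor [sigma ^- 2], the derivative of [se_kernel sigma x y] in the [b]-th coordinate
    of [y]. *)
Let slope y b (x : T) := (x - y) 0 b * se_kernel sigma x y.

Let bounded_measurable_slope y b : bounded_measurable (slope y b).
Proof.
split; last first.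
  exists (1 + 2 * sigma ^+ 2) => x; have /andP[k0 _] := se_kernel_bounds sigma x y.
  by rewrite normrM (ger0_norm k0); exact: coord_se_kernel_le.
apply: measurable_funM; last by case: (bounded_measurable_se_kernel sigma y).
rewrite (_ : (fun x : T => _) = fun x : T => (x : 'rV[R]_d) 0 b - y 0 b).
  by apply: measurable_funB => //; exact: measurable_coord.
by apply/funext => x; rewrite !mxE.
Qed.

Lemma Rintegral_slope y b :
  \int[lebesgue_rV]_x (slope y b x * p x) =
  v1 pi sigma y 0 b - y 0 b * v0 pi sigma y.
Proof.
have int_k := integrable_bounded_mul (bounded_measurable_se_kernel sigma y).
have int_s := integrable_bounded_mul (bounded_measurable_slope y b).
rewrite /v1 mxE /v0.
rewrite (RintegralE (fun x => x 0 b * se_kernel sigma x y)).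
rewrite (RintegralE (fun x => se_kernel sigma x y)).
(* The equation is rearranged so that additivity is applied to [slope] and [y_b] times the kernel,
   both bounded in [x], whereas the factor [x_b] alone is not. *)
rewrite -RintegralZl//; apply/eqP; rewrite eq_sym subr_eq -RintegralD//; last first.
  rewrite (_ : _ \o _ = fun x : T => ((y 0 b)%:E * (se_kernel sigma x y * p x)%:E)%E).
    exact: integrableZl.
  by apply/funext => x /=; rewrite -EFinM.
by apply/eqP/eq_Rintegral => x _; rewrite /slope !mxE; ring.
Qed.

(** The derivative of the integrand is [sigma ^- 2] times [slope] times [p], and
    [coord_se_kernel_le] dominates it, uniformly in [t], by an integrable multiple of [p]. *)
Lemma is_derive_v0 y b :
  is_derive (0 : R) (1 : R) (fun t => v0 pi sigma (t *: 'e_b + y))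
    (sigma ^- 2 * (v1 pi sigma y 0 b - y 0 b * v0 pi sigma y)).
Proof.
pose f (t : R) (x : T) := se_kernel sigma x (t *: 'e_b + y) * p x.
have derf t x : is_derive t (1 : R) (f ^~ x)
    (sigma ^- 2 * slope (t *: 'e_b + y) b x * p x).
  (* Only the second argument of the kernel moves: speeds 0 and 1 in [is_derive_se_kernel]. *)
  have -> : f ^~ x = (fun s => p x * se_kernel sigma ((s * 0) *: 'e_b + x) ((s * 1) *: 'e_b + y)).
    by apply/funext => s; rewrite /f mulr0 scale0r add0r mulr1 mulrC.
  apply: is_derive_eq; first exact/is_deriveMl/is_derive_se_kernel.
  by rewrite mulr0 scale0r !add0r mulr1 mulrN1 opprK mulrC /slope !mulrA.
have d1f t x : partial1of2 f t x = sigma ^- 2 * slope (t *: 'e_b + y) b x * p x.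
  by rewrite partial1of2E; have [_ ->] := derf t x.
apply/is_derive_cvg.
have s2 : 0 <= sigma ^- 2 by rewrite invr_ge0 sqr_ge0.
have vE : v0 pi sigma = fun z => \int[lebesgue_rV]_x (se_kernel sigma x z * p x).
  by apply/funext => z; rewrite /v0 (RintegralE (fun x => se_kernel sigma x z)).
pose C := sigma ^- 2 * (1 + 2 * sigma ^+ 2).
have C0 : 0 <= C by rewrite mulr_ge0// addr_ge0// mulr_ge0// sqr_ge0.
have intf t : lebesgue_rV.-integrable [set: T] (EFin \o f t).
  by apply: integrable_bounded_mul; exact: bounded_measurable_se_kernel.
have intG : lebesgue_rV.-integrable [set: T] (EFin \o (fun x => C * p x)).
  exact: integrableZl (pdf_integrable pi).
have le_normM (a c e K : R) : 0 <= a -> 0 <= e -> `|c| <= K -> `|a * c * e| <= a * K * e.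
  by move=> a0 e0 cK; rewrite !normrM (ger0_norm a0) (ger0_norm e0) ler_wpM2r// ler_wpM2l.
have d1f_ub t x : `|partial1of2 f t x| <= C * p x.
  rewrite d1f; apply: le_normM => //; rewrite /slope normrM.
  have /andP[k0 _] := se_kernel_bounds sigma x (t *: 'e_b + y).
  by rewrite (ger0_norm k0); exact: coord_se_kernel_le.
(* The bounds above hold for every [t], so any open interval around 0 would serve. *)
have I0 : `](-1), 1[%classic (0 : R) by rewrite /= in_itv/= ltrN10 ltr01.
have := cvg_differentiation_under_integral measurableT I0 (fun t _ => intf t)
  (fun t x _ _ => @ex_derive _ _ _ _ _ _ _ (derf t x))
  (fun x => mulr_ge0 C0 (p_ge0 x)) intG (fun t x _ _ => d1f_ub t x).
rewrite (_ : \int[_]_(x in _) partial1of2 f 0 x =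
    sigma ^- 2 * (v1 pi sigma y 0 b - y 0 b * v0 pi sigma y)); last first.
  rewrite -Rintegral_slope -RintegralZl//; last exact: integrable_bounded_mul.
  by apply: eq_Rintegral => x _; rewrite d1f scale0r add0r mulrA.
by under [in X in _ -> X]eq_fun do rewrite /GRing.scale/= mulr1 vE.
Qed.

End derivative_of_v0.

(** * Optimal weights *)

Section optimal_weights.
Context {R : realType} {d M : nat} (X : set 'rV[R]_d) (pi : density X).
Context (sigma lambda : R) (lambda_gt0 : 0 < lambda).
Implicit Types (w : 'cV[R]_M) (Y : 'M[R]_(M, d)).

Local Notation k Y i j := (se_kernel sigma (row i Y) (row j Y)).

(** If [v K_lambda = 0], pairing with [v] gives [v K v^T + lambda |v|^2 = 0]; the first term is
    nonnegative and [lambda > 0], so [v = 0]. *)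
Lemma kernel_reg_unitmx Y : kernel_reg_mx sigma lambda Y \in unitmx.
Proof.
rewrite -row_free_unit; apply: inj_row_free => v vK0.
have vKE j : (v *m kernel_reg_mx sigma lambda Y) 0 j =
    \sum_i v 0 i * k Y i j + lambda * v 0 j.
  by rewrite /kernel_reg_mx mulmxDr mul_mx_scalar !mxE; under eq_bigr do rewrite mxE.
have : \sum_i \sum_j v 0 i * v 0 j * k Y i j + lambda * (\sum_j v 0 j ^+ 2) = 0.
  rewrite exchange_big mulr_sumr -big_split big1//= => j _.
  transitivity ((v *m kernel_reg_mx sigma lambda Y) 0 j * v 0 j).
    rewrite vKE mulrDl mulr_suml; congr (_ + _); last by ring.
    by apply: eq_bigr => i _; ring.
  by rewrite vK0 mxE mul0r.
have psd := psd_se_kernel sigma (fun i => row i Y) (fun i => v 0 i).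
have sq0 : 0 <= \sum_j v 0 j ^+ 2 by apply: sumr_ge0 => j _; exact: sqr_ge0.
move=> eq0; have {}eq0 : \sum_j v 0 j ^+ 2 = 0.
  apply/eqP; rewrite eq_le sq0 andbT -(pmulr_rle0 _ lambda_gt0).
  by move: eq0 psd; lra.
apply/rowP => j; rewrite mxE; apply/eqP; rewrite -sqrf_eq0; apply/eqP.
by apply: (psumr_eq0P _ eq0) => // i _; exact: sqr_ge0.
Qed.

(** The residual of the linear system for the optimal weights; it is minus the gradient of
    [F_weights] in the weights. *)
Definition weights_residual w Y (i : 'I_M) : R :=
  v0 pi sigma (row i Y) - \sum_j k Y i j * w j 0 - lambda * w i 0.

Lemma opt_weights_residual Y i :
  weights_residual (opt_weights pi sigma lambda Y) Y i = 0.
Proof.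
have /(congr1 (fun A : 'cV_M => A i 0)) :
    kernel_reg_mx sigma lambda Y *m opt_weights pi sigma lambda Y = v0_vec pi sigma Y.
  by rewrite /opt_weights mulKVmx// kernel_reg_unitmx.
rewrite /weights_residual {1}/kernel_reg_mx mulmxDl mul_scalar_mx !mxE => <-.
by under eq_bigr do rewrite mxE; ring.
Qed.

(** With [u = z - w] and [r] the residual of [w], the right side minus the left is [u^T K u / 2 +
    |lambda u - r|^2 / (2 lambda)], a sum of nonnegative terms. *)
Lemma F_weights_residual_le w z Y :
  F_weights pi sigma lambda w Y
    - (2 * lambda)^-1 * \sum_i weights_residual w Y i ^+ 2 <=
  F_weights pi sigma lambda z Y.
Proof.
pose u i := z i 0 - w i 0.
have zE i : z i 0 = w i 0 + u i by rewrite /u; ring.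
have psd := psd_se_kernel sigma (fun i => row i Y) u.
have cross : \sum_i \sum_j z i 0 * z j 0 * k Y i j =
    \sum_i \sum_j w i 0 * w j 0 * k Y i j
    + 2 * \sum_i u i * (\sum_j k Y i j * w j 0)
    + \sum_i \sum_j u i * u j * k Y i j.
  have -> : \sum_i u i * (\sum_j k Y i j * w j 0) = \sum_i \sum_j u i * w j 0 * k Y i j.
    apply: eq_bigr => i _; rewrite mulr_sumr; apply: eq_bigr => j _; ring.
  pose S := \sum_i \sum_j u i * w j 0 * k Y i j; rewrite -/S.
  (* Symmetry of the kernel makes the two mixed terms of the expansion equal. *)
  have SC : S = \sum_i \sum_j w i 0 * u j * k Y i j.
    rewrite /S exchange_big; apply: eq_bigr => i _; apply: eq_bigr => j _ /=.
    by rewrite (se_kernelC _ (row i Y)); ring.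
  rewrite [2 * S](_ : _ = S + S); last by ring.
  rewrite {2}SC -!big_split; apply: eq_bigr => i _ /=.
  by rewrite -!big_split; apply: eq_bigr => j _ /=; rewrite !zE; ring.
rewrite !F_weightsE cross -subr_ge0.
set q := \sum_i \sum_j w i 0 * _ * _; set s := \sum_i \sum_j u i * _ * _.
have sqs : 0 <= \sum_i (2 * lambda)^-1 * (lambda * u i - weights_residual w Y i) ^+ 2.
  apply: sumr_ge0 => i _; rewrite mulr_ge0 ?sqr_ge0// invr_ge0 mulr_ge0//.
  exact: ltW.
rewrite [leRHS](_ : _ = 2^-1 * s +
  \sum_i (2 * lambda)^-1 * (lambda * u i - weights_residual w Y i) ^+ 2).
  by rewrite addr_ge0// mulr_ge0.
have lambda0 : lambda != 0 by rewrite gt_eqF.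
have -> : \sum_i (2 * lambda)^-1 * (lambda * u i - weights_residual w Y i) ^+ 2 =
    \sum_i w i 0 * v0 pi sigma (row i Y) - \sum_i z i 0 * v0 pi sigma (row i Y)
    + \sum_i u i * (\sum_j k Y i j * w j 0)
    + lambda / 2 * (\sum_i z i 0 ^+ 2) - lambda / 2 * (\sum_i w i 0 ^+ 2)
    + (2 * lambda)^-1 * \sum_i weights_residual w Y i ^+ 2.
  rewrite !mulr_sumr -!sumrB -!big_split/= -sumrB -big_split/=.
  apply: eq_bigr => i _.
  by rewrite zE /weights_residual; field.
by field.
Qed.

Lemma F_opt_bounds w Y :
  F_weights pi sigma lambda w Y
    - (2 * lambda)^-1 * \sum_i weights_residual w Y i ^+ 2 <=
  F_opt pi sigma lambda Y <= F_weights pi sigma lambda w Y.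
Proof.
apply/andP; split.
  apply: lb_le_inf; first by exists (F_weights pi sigma lambda w Y), w.
  by move=> _ [z _ <-]; exact: F_weights_residual_le.
(* The residual bound also shows that the values are bounded below, which [inf] requires to be a
   lower bound. *)
apply: ge_inf; last by exists w.
exists (F_weights pi sigma lambda w Y
    - (2 * lambda)^-1 * \sum_i weights_residual w Y i ^+ 2).
by move=> _ [z _ <-]; exact: F_weights_residual_le.
Qed.

End optimal_weights.

(** * Partial derivatives of the optimal value *)

Section gradient.
Context {R : realType} {d M : nat} (X : set 'rV[R]_d) (pi : density X).
Context (sigma lambda : R) (sigma_gt0 : 0 < sigma) (lambda_gt0 : 0 < lambda).
Context (Y : 'M[R]_(M, d)) (a : 'I_M) (b : 'I_d).

Local Notation k Z i j := (se_kernel sigma (row i Z) (row j Z)).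
Local Notation "'[ i ]" := ((i == a)%:R : R) (format "''[' i ]").

Let line (t : R) : 'M[R]_(M, d) := t *: delta_mx a b + Y.

(** Row [i] moves along the [b]-th axis with speed 1 or 0, the form that [is_derive_se_kernel]
    expects. *)
Let row_line t i : row i (line t) = (t * '[i]) *: delta_mx 0 b + row i Y.
Proof. by apply/rowP => j; rewrite !mxE/= -mulnb natrM mulrA. Qed.

Let line0 : line 0 = Y.
Proof. by rewrite /line scale0r add0r. Qed.

Definition dv0 i : R :=
  '[i] * (sigma ^- 2 * (v1 pi sigma (row i Y) 0 b - Y i b * v0 pi sigma (row i Y))).

(** The difference of indicators vanishes unless exactly one of the two points moves. *)
Definition dkernel i j : R :=
  - sigma ^- 2 * ('[i] - '[j]) * (Y i b - Y j b) * k Y i j.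

Let is_derive_v0_line i :
  is_derive (0 : R) (1 : R) (fun t => v0 pi sigma (row i (line t))) (dv0 i).
Proof.
under eq_fun do rewrite row_line; rewrite /dv0.
have [ia|ia] := eqVneq i a.
  rewrite mul1r; under eq_fun do rewrite mulr1.
  by have := is_derive_v0 pi sigma_gt0 (row i Y) b; rewrite !mxE.
by rewrite mul0r; under eq_fun do rewrite mulr0 scale0r add0r; exact: is_derive_cst.
Qed.

Let is_derive_kernel_line i j :
  is_derive (0 : R) (1 : R) (fun t => k (line t) i j) (dkernel i j).
Proof.
under eq_fun do rewrite !row_line.
apply: is_derive_eq; first exact: is_derive_se_kernel.
by rewrite !mul0r !scale0r !add0r !mxE.
Qed.

Let is_derive_const (c : R) : is_derive (0 : R) (1 : R) (fun=> c) 0.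
Proof. exact: is_derive_cst. Qed.

Let is_deriveD_fun (f g : R -> R) df dg :
  is_derive (0 : R) (1 : R) f df -> is_derive (0 : R) (1 : R) g dg ->
  is_derive (0 : R) (1 : R) (fun t => f t + g t) (df + dg).
Proof. exact: is_deriveD. Qed.

Let is_deriveB_fun (f g : R -> R) df dg :
  is_derive (0 : R) (1 : R) f df -> is_derive (0 : R) (1 : R) g dg ->
  is_derive (0 : R) (1 : R) (fun t => f t - g t) (df - dg).
Proof. exact: is_deriveB. Qed.

Lemma is_derive_F_weights_line (w : 'cV[R]_M) :
  is_derive (0 : R) (1 : R) (fun t => F_weights pi sigma lambda w (line t))
    (- (\sum_i w i 0 * dv0 i) + 2^-1 * \sum_i \sum_j w i 0 * w j 0 * dkernel i j).
Proof.
pose dA := is_derive_sum_ext (fun i => is_deriveMl (w i 0) (is_derive_v0_line i)).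
pose dB := is_derive_sum_ext (fun i => is_derive_sum_ext (fun j =>
  is_deriveMl (w i 0 * w j 0) (is_derive_kernel_line i j))).
under eq_fun do rewrite F_weightsE.
have := is_deriveD_fun (is_deriveD_fun (is_deriveB_fun (is_derive_const _) dA)
  (is_deriveMl 2^-1 dB)) (is_derive_const _).
by rewrite sub0r addr0; apply.
Qed.

(** The weights are frozen at their optimal value for [Y], and the gap between the two bounds of
    [F_opt_bounds] plays the role of [e] in the squeeze. *)
Lemma is_derive_F_opt_line (w := opt_weights pi sigma lambda Y) :
  is_derive (0 : R) (1 : R) (fun t => F_opt pi sigma lambda (line t))
    (- (\sum_i w i 0 * dv0 i) + 2^-1 * \sum_i \sum_j w i 0 * w j 0 * dkernel i j).
Proof.
pose r i t := weights_residual pi sigma lambda w (line t) i.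
have r0 i : r i 0 = 0 by rewrite /r line0 opt_weights_residual.
apply: (is_derive_squeeze (e := fun t => (2 * lambda)^-1 * \sum_i r i t ^+ 2)).
- exact: is_derive_F_weights_line.
- have derr i : is_derive (0 : R) (1 : R) (r i)
      (dv0 i - \sum_j w j 0 * dkernel i j - 0).
    rewrite /r /weights_residual.
    under eq_fun do under eq_bigr do rewrite mulrC.
    exact: (is_deriveB_fun (is_deriveB_fun (is_derive_v0_line i)
      (is_derive_sum_ext (fun j => is_deriveMl (w j 0) (is_derive_kernel_line i j))))
      (is_derive_const _)).
  (* The gap is a sum of squares of residuals that vanish at [t = 0], so its derivative there is 0
     whatever the derivatives of the residuals. *)
  apply: is_derive_eq (is_deriveMl (2 * lambda)^-1
    (is_derive_sum_ext (fun i => is_deriveX 2 (derr i)))) _.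
  rewrite big1 ?mulr0// => i _.
  by rewrite r0 expr1 mulr0 scale0r.
- by rewrite big1 ?mulr0// => i _; rewrite r0 expr0n.
- by move=> t; exact: F_opt_bounds.
Qed.

Let sum_indicator (h : 'I_M -> R) : \sum_i '[i] * h i = h a.
Proof.
rewrite (bigD1 a)//= eqxx mul1r big1 ?addr0// => i /negbTE ->.
by rewrite mul0r.
Qed.

Let gradient_mxE (w : 'cV[R]_M) :
  (sigma ^- 2 *: (diag_mx w^T
    *m (kernel_reg_mx sigma lambda Y *m diag_mx w^T *m Y - v1_mx pi sigma Y))) a b =
  sigma ^- 2 * (w a 0 * (\sum_j k Y a j * w j 0 * Y j b + lambda * w a 0 * Y a b
    - v1 pi sigma (row a Y) 0 b)).
Proof.
have v1E : v1_mx pi sigma Y a b = v1 pi sigma (row a Y) 0 b by rewrite /v1_mx mxE.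
(* Generalizing [v1_mx] keeps the integral folded while the matrix entries are expanded. *)
rewrite -v1E; move: (v1_mx pi sigma Y) {v1E} => V.
rewrite mul_diag_mx mul_mx_diag !mxE; congr (_ * (_ * (_ - _))).
rewrite -[X in _ + X](sum_indicator (fun j => lambda * w j 0 * Y j b)) -big_split.
by apply: eq_bigr => j _ /=; rewrite !mxE eq_sym -mulr_natr; ring.
Qed.

(** The equation for the optimal weights in row [a] replaces [v0] by [(K w)_a + lambda w_a]; the
    part [Y_ab (K w)_a] then cancels against the derivative of the quadratic form. *)
Lemma gradientE (w := opt_weights pi sigma lambda Y) :
  - (\sum_i w i 0 * dv0 i) + 2^-1 * \sum_i \sum_j w i 0 * w j 0 * dkernel i j =
  (sigma ^- 2 *: (opt_weights_mx pi sigma lambda Y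
    *m (kernel_reg_mx sigma lambda Y *m opt_weights_mx pi sigma lambda Y *m Y
        - v1_mx pi sigma Y))) a b.
Proof.
have res : v0 pi sigma (row a Y) = \sum_j k Y a j * w j 0 + lambda * w a 0.
  by have := opt_weights_residual pi sigma lambda_gt0 Y a; rewrite /weights_residual -/w; lra.
have v0S : \sum_i w i 0 * dv0 i =
    sigma ^- 2 * w a 0 * (v1 pi sigma (row a Y) 0 b - Y a b * v0 pi sigma (row a Y)).
  rewrite -[RHS](sum_indicator (fun i => sigma ^- 2 * w i 0 *
    (v1 pi sigma (row i Y) 0 b - Y i b * v0 pi sigma (row i Y)))).
  by apply: eq_bigr => i _; rewrite /dv0; ring.
(* [h a] is the contribution of row [a] of the kernel matrix; column [a] contributes the same by
   symmetry, which cancels the factor [2^-1]. *)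
pose h i := \sum_j w i 0 * w j 0 * (- sigma ^- 2 * (Y i b - Y j b) * k Y i j).
have kS : \sum_i \sum_j w i 0 * w j 0 * dkernel i j = h a + h a.
  rewrite -[h a]sum_indicator -big_split/= /h.
  transitivity (\sum_i \sum_j '[i] * (w i 0 * w j 0 * (- sigma ^- 2 * (Y i b - Y j b) * k Y i j))
     + \sum_i \sum_j '[j] * (w i 0 * w j 0 * (- sigma ^- 2 * (Y j b - Y i b) * k Y i j))).
    rewrite -big_split; apply: eq_bigr => i _; rewrite -big_split; apply: eq_bigr => j _ /=.
    by rewrite /dkernel; ring.
  rewrite [X in _ + X]exchange_big -big_split; apply: eq_bigr => i _ /=.
  rewrite !mulr_sumr; congr (_ + _); apply: eq_bigr => j _.
  by rewrite (se_kernelC _ (row j Y)); ring.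
rewrite v0S kS res.
have -> : h a = - sigma ^- 2 * w a 0 *
    (Y a b * \sum_j k Y a j * w j 0 - \sum_j k Y a j * w j 0 * Y j b).
  rewrite /h mulr_sumr -sumrB mulr_sumr; apply: eq_bigr => j _; ring.
have := gradient_mxE w; rewrite /w => ->; rewrite -/w.
by move: (sigma ^- 2) => s; field.
Qed.

End gradient.

Theorem theorem3p1 (R : realType) (d M : nat) (X : set 'rV[R]_d)
    (pi : density X) (sigma lambda : R)
    (sigma_gt0 : 0 < sigma) (lambda_gt0 : 0 < lambda) (M_ge1 : (1 <= M)%N)
    (Y : 'M[R]_(M, d)) (YX : forall i : 'I_M, X (row i Y)) :
  is_gradient (F_opt pi sigma lambda) Y
    (sigma ^- 2 *: (opt_weights_mx pi sigma lambda Y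
       *m (kernel_reg_mx sigma lambda Y *m opt_weights_mx pi sigma lambda Y *m Y
           - v1_mx pi sigma Y))).
Proof.
move=> a b; apply: is_derive_line; rewrite -gradientE//.
exact: is_derive_F_opt_line.
Qed.
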